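(* The mappings $\varepsilon^i$, $i=1,2,3$, are symmetries of the exponential mapping of spacelike normal extremals, i.e. $$(\varepsilon^i\circ\mathrm{Exp})(\theta,c,\alpha,t)=(\mathrm{Exp}\circ\varepsilon^i)(\theta,c,\alpha,t),\qquad (\theta,c,\alpha,t)\in N.$$
   Context: Spacelike normal extremals in the sub-Lorentzian Engel group $M=\mathbb{R}^4$ (coordinates $q=(x_1,x_2,y,z)$), on the level $H=1/2$ with $h_1=\sinh\theta$, $h_2=\cosh\theta$, $h_3=c$, $h_4=\alpha$, satisfy $$\dot x_1=-\sinh\theta,\ \dot x_2=\cosh\theta,\ \dot y=\tfrac12(x_2\sinh\theta+x_1\cosh\theta),\ \dot z=\tfrac{x_1^2+x_2^2}{2}\cosh\theta,\ \dot\theta=-c,\ \dot c=-\alpha\sinh\theta,\ \dot\alpha=0,$$ with $q(0)=0$. Let $C=\{\lambda=(\theta,c,\alpha)\in\mathbb{R}^3\}$. For $\lambda\in C$ let $t_{\mathrm{supr}}(\lambda)\in(0,+\infty]$ be the explosion (maximal forward existence) time of the solution with initial values $\lambda$, $q(0)=0$; let $N=\{(\lambda,t): \lambda\in C,\ 0<t<t_{\mathrm{supr}}(\lambda)\}$ and $\mathrm{Exp}:N\to M$, $\mathrm{Exp}(\lambda,t)=q(t)$. Action on $N$: on $C$ put $\varepsilon^1(\theta,c,\alpha)=(\theta,-c,\alpha)$, $\varepsilon^2(\theta,c,\alpha)=(-\theta,c,\alpha)$, $\varepsilon^3(\theta,c,\alpha)=(-\theta,-c,\alpha)$, and let $e^{t\vec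 H_v}$ be the flow on $C$ of $\vec H_v=-c\,\partial_\theta-\alpha\sinh\theta\,\partial_c$. Then $\varepsilon^i(\lambda,t)=(\varepsilon^i\circ e^{t\vec H_v}(\lambda),t)$ for $i=1,2$ and $\varepsilon^3(\lambda,t)=(\varepsilon^3(\lambda),t)$. Action on $M$: $\varepsilon^1(x_1,x_2,y,z)=(x_1,x_2,-y,z-x_1y)$, $\varepsilon^2(x_1,x_2,y,z)=(-x_1,x_2,y,z-x_1y)$, $\varepsilon^3(x_1,x_2,y,z)=(-x_1,x_2,-y,z)$. *)

(* Defs.v *)
From Stdlib Require Import Reals ClassicalEpsilon.
From Coquelicot Require Import Coquelicot.

Open Scope R_scope.

Definition integral_curve {V : NormedModule R_AbsRing} (F : V -> V) (v0 : V)
    (a b : R) (g : R -> V) : Prop :=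
  a < 0 < b /\ g 0 = v0 /\ forall s : R, a < s < b -> is_derive g s (F (g s)).

(* Maximal forward existence time: supremum of the right endpoints of the open
   intervals around 0 carrying an integral curve that starts at v0. *)
Definition explosion_time {V : NormedModule R_AbsRing} (F : V -> V) (v0 : V) : Rbar :=
  Lub_Rbar (fun b : R => exists (a : R) (g : R -> V), integral_curve F v0 a b g).

(* Value at time t of an integral curve from v0 defined up to time t; it does not
   depend on the curve when F is locally Lipschitz, as the fields below are.
   Unspecified if no integral curve from v0 reaches time t. *)
Definition flow {V : NormedModule R_AbsRing} (F : V -> V) (t : R) (v0 : V) : V :=
  epsilon (inhabits v0) (fun v : V =>
    exists (a b : R) (g : R -> V),
      integral_curve F v0 a b g /\ a < t < b /\ g t = v).

(* q = (x1, x2, y, z) *)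
Definition M : Type := (R * R * R * R)%type.

(* lambda = (theta, c, alpha); named Cov since Coquelicot's C is the complex field. *)
Definition Cov : Type := (R * R * R)%type.

Definition q0 : M := (0, 0, 0, 0).

Definition Hv (lam : R * R * R) : R * R * R :=
  let '(theta, c, alpha) := lam in (- c, - alpha * sinh theta, 0).

Definition H_field (p : (R * R * R) * (R * R * R * R)) : (R * R * R) * (R * R * R * R) :=
  let '(lam, q) := p in
  let '(theta, c, alpha) := lam in
  let '(x1, x2, y, z) := q in
  (Hv lam,
   (- sinh theta,
    cosh theta,
    / 2 * (x2 * sinh theta + x1 * cosh theta),
    (x1 ^ 2 + x2 ^ 2) / 2 * cosh theta)).

Definition t_supr (lam : Cov) : Rbar := explosion_time H_field (lam, q0).

Definition N_dom (p : Cov * R) : Prop :=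
  let '(lam, t) := p in 0 < t /\ Rbar_lt t (t_supr lam).

Definition Exp (p : Cov * R) : M :=
  let '(lam, t) := p in snd (flow H_field t (lam, q0)).

Inductive sym : Set := eps1 | eps2 | eps3.

Definition eps_C (i : sym) (lam : Cov) : Cov :=
  let '(theta, c, alpha) := lam in
  match i with
  | eps1 => (theta, - c, alpha)
  | eps2 => (- theta, c, alpha)
  | eps3 => (- theta, - c, alpha)
  end.

Definition eps_N (i : sym) (p : Cov * R) : Cov * R :=
  let '(lam, t) := p in
  match i with
  | eps1 | eps2 => (eps_C i (flow Hv t lam), t)
  | eps3 => (eps_C i lam, t)
  end.

Definition eps_M (i : sym) (q : M) : M :=
  let '(x1, x2, y, z) := q in
  match i with
  | eps1 => (x1, x2, - y, z - x1 * y)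
  | eps2 => (- x1, x2, y, z - x1 * y)
  | eps3 => (- x1, x2, - y, z)
  end.

(* Main.v *)
(* For eps1, reverse time: if (theta, c, alpha, q) is an extremal on (a, b) and a < t < b, then
   s |-> (theta (t - s), - c (t - s), alpha (t - s)) again solves the vertical system, and the
   q-part it drives from the origin is a polynomial expression in q(t) and q(t - s) whose value
   at s = t is eps1 (q(t)).  For eps3, changing the signs of theta, c, x1, y maps extremals to
   extremals.  Finally eps2 = eps3 o eps1, both on N and on M.  Since [flow] is chosen among
   integral curves, these curves compute Exp only through uniqueness: a Gronwall estimate for
   (theta, c), after which q is determined by quadrature. *)

Require Import Defs.
From Stdlib Require Import Reals Lra Classical ClassicalEpsilon.
From Coquelicot Require Import Coquelicot.
Open Scope R_scope.

(** * Derivatives of pairs and scalar differential inequalities *)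

(** Projections are linear, and pairing is its own differential. Iterating this splits a vector
    equation into scalar ones. *)
Lemma is_derive_pair {U V : NormedModule R_AbsRing} (g : R -> U * V) (s : R) (l : U * V) :
  is_derive g s l <->
  is_derive (fun u => fst (g u)) s (fst l) /\ is_derive (fun u => snd (g u)) s (snd l).
Proof.
split.
- intros Hg; split.
  + apply (filterdiff_ext_lin _ (fun y : R_AbsRing => fst (scal y l))); [|intros y; reflexivity].
    apply (filterdiff_comp' g fst s _ fst Hg).
    apply filterdiff_linear, is_linear_fst.
  + apply (filterdiff_ext_lin _ (fun y : R_AbsRing => snd (scal y l))); [|intros y; reflexivity].
    apply (filterdiff_comp' g snd s _ snd Hg).
    apply filterdiff_linear, is_linear_snd.
- intros [H1 H2].
  apply (filterdiff_ext (fun u => (fst (g u), snd (g u)))).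
  { intros u; symmetry; apply surjective_pairing. }
  apply (filterdiff_ext_lin _ (fun y : R_AbsRing => (scal y (fst l), scal y (snd l)))).
  2:{ intros y; destruct l; reflexivity. }
  apply (filterdiff_comp'_2 (fun u => fst (g u)) (fun u => snd (g u)) (fun u v => (u, v))
          s _ _ (fun u v => (u, v)) H1 H2).
  apply (filterdiff_ext_lin _ (fun x : U * V => x)); [|intros [? ?]; reflexivity].
  apply (filterdiff_ext (fun x : U * V => x)); [intros [? ?]; reflexivity|].
  apply filterdiff_id.
Qed.

Lemma is_derive_continuity_pt (f : R -> R) (x l : R) : is_derive f x l -> continuity_pt f x.
Proof.
intros H. apply derivable_continuous_pt. exists l. now apply is_derive_Reals.
Qed.

Lemma derive_nonpos_le (f df : R -> R) (a b : R) :
  a <= b -> (forall s, a <= s <= b -> is_derive f s (df s)) ->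
  (forall s, a <= s <= b -> df s <= 0) -> f b <= f a.
Proof.
intros Hab Hd Hn.
destruct (MVT_gen f a b df) as [xi [Hxi E]].
- intros x Hx. rewrite Rmin_left, Rmax_right in Hx by lra. apply Hd; lra.
- intros x Hx. rewrite Rmin_left, Rmax_right in Hx by lra.
  apply (is_derive_continuity_pt f x (df x)), Hd; lra.
- rewrite Rmin_left, Rmax_right in Hxi by lra.
  specialize (Hn xi Hxi). nra.
Qed.

(** The difference has zero derivative, so by [derive_nonpos_le] it does not increase; exchanging
    the roles of [f] and [g] gives the other inequality. This is the quadrature principle used for
    alpha and for q. *)
Lemma same_derive_eq (f g df : R -> R) (a b : R) :
  a <= b -> f a = g a ->
  (forall s, a <= s <= b -> is_derive f s (df s)) ->
  (forall s, a <= s <= b -> is_derive g s (df s)) -> f b = g b.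
Proof.
intros Hab E Hf Hg.
assert (H : forall h k : R -> R, h a = k a ->
  (forall s, a <= s <= b -> is_derive h s (df s)) ->
  (forall s, a <= s <= b -> is_derive k s (df s)) -> h b <= k b).
{ intros h k E' Hh Hk.
  enough (h b - k b <= h a - k a) by lra.
  apply (derive_nonpos_le (fun s => h s - k s) (fun s => df s - df s)); trivial.
  - intros s Hs. apply (is_derive_minus (V := R_NormedModule)); auto.
  - intros; lra. }
apply Rle_antisym; auto.
Qed.

(** The product of [D s] with [exp (- L * s)] is nonincreasing, and the exponential factor is
    positive. It is applied to a squared distance. *)
Lemma gronwall_zero (D dD : R -> R) (L a b : R) :
  a <= b -> (forall s, a <= s <= b -> is_derive D s (dD s)) ->
  (forall s, a <= s <= b -> dD s <= L * D s) -> D a <= 0 -> D b <= 0.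
Proof.
intros Hab Hd HL H0.
assert (H : D b * exp (- L * b) <= D a * exp (- L * a)).
{ apply (derive_nonpos_le (fun s => D s * exp (- L * s))
    (fun s => (dD s - L * D s) * exp (- L * s))); trivial.
  - intros s Hs. specialize (Hd s Hs). auto_derive.
    + now exists (dD s).
    + rewrite (is_derive_unique (fun x : R => D x) s (dD s) Hd). ring.
  - intros s Hs. specialize (HL s Hs). generalize (exp_pos (- L * s)). nra. }
generalize (exp_pos (- L * b)) (exp_pos (- L * a)). nra.
Qed.

Lemma cosh_le_exp_Rabs (x : R) : cosh x <= exp (Rabs x).
Proof.
assert (H : forall u, u <= Rabs x -> exp u <= exp (Rabs x)).
{ intros u [Hu| ->]; [left; apply exp_increasing; trivial | right; trivial]. }
assert (Hx : - x <= Rabs x) by (rewrite <- Rabs_Ropp; apply Rle_abs).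
generalize (H x (Rle_abs x)) (H (- x) Hx). unfold cosh. lra.
Qed.

Lemma is_derive_sinh (x : R) : is_derive sinh x (cosh x).
Proof. apply is_derive_Reals, derivable_pt_lim_sinh. Qed.

(** By the mean value theorem: the intermediate point also has absolute value at most [B], where
    [cosh] is bounded by [exp B]. *)
Lemma sinh_lipschitz (B x y : R) :
  Rabs x <= B -> Rabs y <= B -> Rabs (sinh x - sinh y) <= exp B * Rabs (x - y).
Proof.
intros Hx Hy.
destruct (MVT_gen sinh y x cosh) as [xi [Hxi E]].
- intros; apply is_derive_sinh.
- intros u _. apply (is_derive_continuity_pt sinh u (cosh u)), is_derive_sinh.
- rewrite E, Rabs_mult. apply Rmult_le_compat_r; [apply Rabs_pos|].
  assert (Hb : Rabs xi <= B).
  { apply Rabs_le_between in Hx. apply Rabs_le_between in Hy. apply Rabs_le_between.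
    destruct (Rle_dec y x).
    - rewrite Rmin_left, Rmax_right in Hxi; lra.
    - rewrite Rmin_right, Rmax_left in Hxi; lra. }
  rewrite Rabs_pos_eq.
  + eapply Rle_trans; [apply cosh_le_exp_Rabs|].
    destruct Hb as [Hb| ->]; [left; apply exp_increasing; trivial | right; trivial].
  + unfold cosh. generalize (exp_pos xi) (exp_pos (- xi)). lra.
Qed.

Lemma is_derive_bounded (f df : R -> R) (a b : R) :
  a <= b -> (forall s, a <= s <= b -> is_derive f s (df s)) ->
  exists B, forall s, a <= s <= b -> Rabs (f s) <= B.
Proof.
intros Hab Hd.
destruct (continuity_ab_maj (fun s => Rabs (f s)) a b Hab) as [m [Hm _]].
- intros s Hs. apply (continuity_pt_comp f Rabs), (Rcontinuity_abs (f s)).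
  apply (is_derive_continuity_pt f s (df s)); auto.
- exists (Rabs (f m)); exact Hm.
Qed.

(** * The vertical and full systems in coordinates *)

Lemma Hv_coords (g : R -> R * R * R) (s : R) :
  is_derive g s (Hv (g s)) <->
  is_derive (fun u => fst (fst (g u))) s (- snd (fst (g s))) /\
  is_derive (fun u => snd (fst (g u))) s (- snd (g s) * sinh (fst (fst (g s)))) /\
  is_derive (fun u => snd (g u)) s 0.
Proof.
rewrite 2!is_derive_pair.
destruct (g s) as [[th c] al]; simpl. tauto.
Qed.

Lemma H_field_coords (g : R -> (R * R * R) * (R * R * R * R)) (s : R) :
  is_derive g s (H_field (g s)) <->
  is_derive (fun u => fst (g u)) s (Hv (fst (g s))) /\
  (let th := fst (fst (fst (g s))) in
   let q u := snd (g u) in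
   let x1 u := fst (fst (fst (q u))) in
   let x2 u := snd (fst (fst (q u))) in
   is_derive x1 s (- sinh th) /\
   is_derive x2 s (cosh th) /\
   is_derive (fun u => snd (fst (q u))) s (/ 2 * (x2 s * sinh th + x1 s * cosh th)) /\
   is_derive (fun u => snd (q u)) s ((x1 s ^ 2 + x2 s ^ 2) / 2 * cosh th)).
Proof.
rewrite is_derive_pair, (is_derive_pair (fun u => snd (g u))),
  (is_derive_pair (fun u => fst (snd (g u)))),
  (is_derive_pair (fun u => fst (fst (snd (g u))))).
cbv beta zeta. destruct (g s) as [[[th c] al] [[[x1 x2] y] z]]; simpl. tauto.
Qed.

(** * Uniqueness of integral curves and the value of [flow] *)

Definition unique_forward {V : NormedModule R_AbsRing} (F : V -> V) : Prop :=
  forall (v0 : V) (a1 b1 a2 b2 : R) (g1 g2 : R -> V) (t : R),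
    integral_curve F v0 a1 b1 g1 -> integral_curve F v0 a2 b2 g2 ->
    0 <= t -> t < b1 -> t < b2 -> g1 t = g2 t.

(** The curve [g] shows that the predicate under [epsilon] is satisfiable, so the chosen value lies
    on some integral curve, which agrees with [g] at [t] by uniqueness. *)
Lemma flow_eq {V : NormedModule R_AbsRing} (F : V -> V) (v0 : V) (a b t : R) (g : R -> V) :
  unique_forward F -> integral_curve F v0 a b g -> 0 <= t < b -> flow F t v0 = g t.
Proof.
intros HF Hg Ht. unfold flow.
match goal with |- epsilon ?i ?P = _ => destruct (epsilon_spec i P) as (a' & b' & h & Hh & Ht' & <-) end.
- exists (g t), a, b, g. repeat split; try apply Hg; try lra.
  destruct Hg as [? _]; lra.
- apply (HF v0 a' b' a b); trivial; lra.
Qed.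

(** Both curves keep alpha at its initial value; what remains is a system for theta and c that is
    Lipschitz along the two bounded trajectories, so the Gronwall estimate applies. *)
Lemma Hv_unique_forward : unique_forward Hv.
Proof.
intros v0 a1 b1 a2 b2 g1 g2 t (Hab1 & E1 & D1) (Hab2 & E2 & D2) H0 H1 H2.
assert (G1 : forall s, 0 <= s <= t -> is_derive g1 s (Hv (g1 s))) by (intros; apply D1; lra).
assert (G2 : forall s, 0 <= s <= t -> is_derive g2 s (Hv (g2 s))) by (intros; apply D2; lra).
setoid_rewrite Hv_coords in G1. setoid_rewrite Hv_coords in G2.
assert (Eal1 : forall s, 0 <= s <= t -> snd (g1 s) = snd v0).
{ intros s Hs. apply (same_derive_eq (fun s => snd (g1 s)) (fun _ => snd v0) (fun _ => 0) 0); try lra.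
  - now rewrite E1.
  - intros u Hu; apply G1; lra.
  - intros u _; apply (is_derive_const (V := R_NormedModule)). }
assert (Eal2 : forall s, 0 <= s <= t -> snd (g2 s) = snd v0).
{ intros s Hs. apply (same_derive_eq (fun s => snd (g2 s)) (fun _ => snd v0) (fun _ => 0) 0); try lra.
  - now rewrite E2.
  - intros u Hu; apply G2; lra.
  - intros u _; apply (is_derive_const (V := R_NormedModule)). }
set (th1 := fun s => fst (fst (g1 s))) in *. set (c1 := fun s => snd (fst (g1 s))) in *.
set (th2 := fun s => fst (fst (g2 s))) in *. set (c2 := fun s => snd (fst (g2 s))) in *.
(* Bounds for both theta components on the compact interval from 0 to t; they yield the Lipschitz
   constant [K] of [sinh] there. *)
destruct (is_derive_bounded th1 (fun s => - c1 s) 0 t H0) as [B1 HB1]; [intros; now apply G1|].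
destruct (is_derive_bounded th2 (fun s => - c2 s) 0 t H0) as [B2 HB2]; [intros; now apply G2|].
set (al := snd v0) in *.
set (K := exp (Rmax B1 B2)).
(* With u and v the differences in theta and c, the derivative of u^2 + v^2 is -2uv - 2 al v S,
   where |S| <= K |u|. Since 2|uv| <= u^2 + v^2, the Gronwall constant is 1 + |al| K. *)
assert (HD : (th1 t - th2 t) ^ 2 + (c1 t - c2 t) ^ 2 <= 0).
{ apply (gronwall_zero (fun s => (th1 s - th2 s) ^ 2 + (c1 s - c2 s) ^ 2)
    (fun s => - 2 * (th1 s - th2 s) * (c1 s - c2 s)
              - 2 * al * (c1 s - c2 s) * (sinh (th1 s) - sinh (th2 s)))
    (1 + Rabs al * K) 0 t H0).
  - intros s Hs.
    destruct (G1 s Hs) as (A1 & A2 & _). destruct (G2 s Hs) as (A3 & A4 & _).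
    assert (A2' : is_derive c1 s (- al * sinh (th1 s))) by (rewrite <- (Eal1 s Hs); exact A2).
    assert (A4' : is_derive c2 s (- al * sinh (th2 s))) by (rewrite <- (Eal2 s Hs); exact A4).
    auto_derive.
    + repeat split; eexists; eassumption.
    + rewrite (is_derive_unique (fun x : R => th1 x) _ _ A1), (is_derive_unique (fun x : R => c1 x) _ _ A2'),
        (is_derive_unique (fun x : R => th2 x) _ _ A3), (is_derive_unique (fun x : R => c2 x) _ _ A4').
      change (snd (fst (g1 s))) with (c1 s). change (snd (fst (g2 s))) with (c2 s). ring.
  - intros s Hs.
    assert (HS := sinh_lipschitz (Rmax B1 B2) (th1 s) (th2 s)
      (Rle_trans _ _ _ (HB1 s Hs) (Rmax_l _ _)) (Rle_trans _ _ _ (HB2 s Hs) (Rmax_r _ _))).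
    fold K in HS. set (S := sinh (th1 s) - sinh (th2 s)) in *.
    set (u := th1 s - th2 s) in *. set (v := c1 s - c2 s) in *.
    assert (HK : 0 < K) by apply exp_pos.
    assert (Ha := Rabs_pos al).
    assert (P1 : - (2 * al * v * S) <= Rabs al * (2 * Rabs v * (K * Rabs u))).
    { eapply Rle_trans; [apply Rle_abs|].
      rewrite Rabs_Ropp, !Rabs_mult, (Rabs_pos_eq 2) by lra.
      replace (2 * Rabs al * Rabs v * Rabs S) with (Rabs al * (2 * Rabs v * Rabs S)) by ring.
      apply Rmult_le_compat_l; trivial. apply Rmult_le_compat_l; trivial.
      generalize (Rabs_pos v); lra. }
    assert (P2 : 2 * Rabs v * Rabs u <= u ^ 2 + v ^ 2).
    { rewrite <- (pow2_abs u), <- (pow2_abs v). generalize (pow2_ge_0 (Rabs u - Rabs v)). lra. }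
    assert (P3 : Rabs al * K * (2 * Rabs v * Rabs u) <= Rabs al * K * (u ^ 2 + v ^ 2)).
    { apply Rmult_le_compat_l; trivial. apply Rmult_le_pos; lra. }
    generalize (pow2_ge_0 (u + v)); lra.
  - unfold th1, th2, c1, c2. rewrite E1, E2. right; ring. }
assert (Sq : forall u v : R, u ^ 2 + v ^ 2 <= 0 -> u = 0).
{ intros u v H. apply Rsqr_0_uniq. rewrite Rsqr_pow2.
  generalize (pow2_ge_0 u) (pow2_ge_0 v). lra. }
assert (Eth := Rminus_diag_uniq _ _ (Sq _ _ HD)).
rewrite Rplus_comm in HD.
assert (Ec := Rminus_diag_uniq _ _ (Sq _ _ HD)).
assert (Eal : snd (g1 t) = snd (g2 t)) by (rewrite Eal1, Eal2; lra).
unfold th1, th2, c1, c2 in *.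
destruct (g1 t) as [[? ?] ?], (g2 t) as [[? ?] ?]; simpl in *; subst; trivial.
Qed.

(** The vertical subsystem does not involve q. *)
Lemma integral_curve_fst (p : (R * R * R) * (R * R * R * R)) (a b : R)
    (g : R -> (R * R * R) * (R * R * R * R)) :
  integral_curve H_field p a b g -> integral_curve Hv (fst p) a b (fun s => fst (g s)).
Proof.
intros (Hab & E & D). split; [trivial|split].
- now rewrite E.
- intros s Hs. now apply H_field_coords, D.
Qed.

(** The system is triangular: the covectors agree by [Hv_unique_forward], hence x1 and x2 have equal
    derivatives along both curves, and then so do y and z, whose derivatives involve only theta, x1
    and x2. *)
Lemma H_field_unique_forward : unique_forward H_field.
Proof.
intros p a1 b1 a2 b2 g1 g2 t I1 I2 H0 H1 H2.
assert (EC : forall s, 0 <= s <= t -> fst (g1 s) = fst (g2 s)).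
{ intros s Hs.
  apply (Hv_unique_forward _ _ _ _ _ _ _ s (integral_curve_fst _ _ _ _ I1)
           (integral_curve_fst _ _ _ _ I2)); lra. }
destruct I1 as (Hab1 & E1 & D1). destruct I2 as (Hab2 & E2 & D2).
assert (G1 : forall s, 0 <= s <= t -> is_derive g1 s (H_field (g1 s))) by (intros; apply D1; lra).
assert (G2 : forall s, 0 <= s <= t -> is_derive g2 s (H_field (g2 s))) by (intros; apply D2; lra).
clear D1 D2.
setoid_rewrite H_field_coords in G1. setoid_rewrite H_field_coords in G2.
cbv beta zeta in G1, G2.
assert (Ex1 : forall s, 0 <= s <= t -> fst (fst (fst (snd (g1 s)))) = fst (fst (fst (snd (g2 s))))).
{ intros s Hs.
  apply (same_derive_eq (fun s => fst (fst (fst (snd (g1 s))))) (fun s => fst (fst (fst (snd (g2 s)))))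
    (fun s => - sinh (fst (fst (fst (g1 s))))) 0); try lra.
  - now rewrite E1, E2.
  - intros u Hu. apply G1; lra.
  - intros u Hu. rewrite EC by lra. apply G2; lra. }
assert (Ex2 : forall s, 0 <= s <= t -> snd (fst (fst (snd (g1 s)))) = snd (fst (fst (snd (g2 s))))).
{ intros s Hs.
  apply (same_derive_eq (fun s => snd (fst (fst (snd (g1 s))))) (fun s => snd (fst (fst (snd (g2 s)))))
    (fun s => cosh (fst (fst (fst (g1 s))))) 0); try lra.
  - now rewrite E1, E2.
  - intros u Hu. apply G1; lra.
  - intros u Hu. rewrite EC by lra. apply G2; lra. }
assert (Ey : snd (fst (snd (g1 t))) = snd (fst (snd (g2 t)))).
{ apply (same_derive_eq (fun s => snd (fst (snd (g1 s)))) (fun s => snd (fst (snd (g2 s))))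
    (fun s => / 2 * (snd (fst (fst (snd (g1 s)))) * sinh (fst (fst (fst (g1 s)))) +
                     fst (fst (fst (snd (g1 s)))) * cosh (fst (fst (fst (g1 s)))))) 0); trivial.
  - now rewrite E1, E2.
  - intros u Hu. now apply G1.
  - intros u Hu. rewrite EC, Ex1, Ex2 by lra. now apply G2. }
assert (Ez : snd (snd (g1 t)) = snd (snd (g2 t))).
{ apply (same_derive_eq (fun s => snd (snd (g1 s))) (fun s => snd (snd (g2 s)))
    (fun s => (fst (fst (fst (snd (g1 s)))) ^ 2 + snd (fst (fst (snd (g1 s)))) ^ 2) / 2
              * cosh (fst (fst (fst (g1 s))))) 0); trivial.
  - now rewrite E1, E2.
  - intros u Hu. now apply G1.
  - intros u Hu. rewrite EC, Ex1, Ex2 by lra. now apply G2. }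
specialize (EC t). specialize (Ex1 t). specialize (Ex2 t).
destruct (g1 t) as [l1 [[[? ?] ?] ?]], (g2 t) as [l2 [[[? ?] ?] ?]]; simpl in *.
rewrite EC, Ex1, Ex2, Ey, Ez by lra. reflexivity.
Qed.

(** * The sign change [eps3] *)

Lemma sinh_opp (x : R) : sinh (- x) = - sinh x.
Proof. unfold sinh. rewrite Ropp_involutive. field. Qed.

Lemma cosh_opp (x : R) : cosh (- x) = cosh x.
Proof. unfold cosh. rewrite Ropp_involutive. field. Qed.

Definition reflect3 (g : R -> Cov * M) (s : R) : Cov * M :=
  (eps_C eps3 (fst (g s)), eps_M eps3 (snd (g s))).

(** As [sinh] is odd and [cosh] even, the right-hand sides for theta, c, x1 and y change sign, while
    those for alpha, x2 and z are unchanged. *)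
Lemma integral_curve_reflect3 (lam : Cov) (a b : R) (g : R -> Cov * M) :
  integral_curve H_field (lam, q0) a b g ->
  integral_curve H_field (eps_C eps3 lam, q0) a b (reflect3 g).
Proof.
intros (Hab & E & D). split; [trivial|split].
- unfold reflect3. rewrite E. simpl. now rewrite Ropp_0.
- intros s Hs. specialize (D s Hs).
  apply H_field_coords in D. destruct D as (D0 & D1 & D2 & D3 & D4).
  apply Hv_coords in D0. destruct D0 as (Dth & Dc & Dal). cbv beta zeta in *.
  apply (is_derive_ext
    (fun u => ((- fst (fst (fst (g u))), - snd (fst (fst (g u))), snd (fst (g u))),
      (- fst (fst (fst (snd (g u)))), snd (fst (fst (snd (g u)))),
       - snd (fst (snd (g u))), snd (snd (g u)))))).
  { intros u. unfold reflect3. destruct (g u) as [[[? ?] ?] [[[? ?] ?] ?]]. reflexivity. }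
  unfold reflect3.
  assert (Opp : forall (f : R -> R) (l l' : R), is_derive f s l -> l' = - l -> is_derive (fun u => - f u) s l').
  { intros f l l' Hf ->. exact (is_derive_opp (V := R_NormedModule) f s l Hf). }
  destruct (g s) as [[[th c] al] [[[x1 x2] y] z]] eqn:Eg.
  rewrite !is_derive_pair. cbn [fst snd H_field Hv eps_C eps_M] in *.
  rewrite sinh_opp, cosh_opp.
  refine (conj (conj (conj _ _) _) (conj (conj (conj _ _) _) _)).
  + apply (Opp (fun u => fst (fst (fst (g u)))) (- c)); [exact Dth | ring].
  + apply (Opp (fun u => snd (fst (fst (g u)))) (- al * sinh th)); [exact Dc | ring].
  + exact Dal.
  + apply (Opp (fun u => fst (fst (fst (snd (g u))))) (- sinh th)); [exact D1 | ring].
  + exact D2.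
  + eapply (Opp (fun u => snd (fst (snd (g u))))); [exact D3 | ring].
  + replace ((- x1) ^ 2) with (x1 ^ 2) by ring. exact D4.
Qed.

(** * Time reversal and [eps1] *)

Lemma state_eq (th th' c c' al al' x1 x1' x2 x2' y y' z z' : R) :
  th = th' -> c = c' -> al = al' -> x1 = x1' -> x2 = x2' -> y = y' -> z = z' ->
  ((th, c, al), (x1, x2, y, z)) = ((th', c', al'), (x1', x2', y', z')).
Proof. now intros -> -> -> -> -> -> ->. Qed.

(* The q-component is the integral from q0 along the reversed controls; the last entry
   integrates ((X1 - x1)^2 + (X2 - x2)^2) / 2 * cosh theta in closed form by means of
   x1 dx2 = dy + d(x1 x2) / 2. *)
Definition reflect1 (t : R) (g : R -> Cov * M) (s : R) : Cov * M :=
  let '(_, (X1, X2, Y, Z)) := g t in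
  let '(theta, c, alpha, (x1, x2, y, z)) := g (t - s) in
  ((theta, - c, alpha),
   (X1 - x1, X2 - x2, / 2 * (X1 * (X2 - x2) - X2 * (X1 - x1)) - (Y - y),
    (X1 ^ 2 + X2 ^ 2) / 2 * (X2 - x2)
    - X1 * ((Y - y) + / 2 * (X1 * X2 - x1 * x2))
    - X2 * ((X2 ^ 2 - x2 ^ 2) / 2) + (Z - z))).

(** At s = t the curve [g] is read at time 0, where q vanishes. The quadratic terms in the third
    entry cancel, as do the cubic terms in the last, leaving -Y and Z - X1 Y. *)
Lemma reflect1_end (t : R) (lam : Cov) (g : R -> Cov * M) :
  g 0 = (lam, q0) ->
  reflect1 t g t = (eps_C eps1 lam, eps_M eps1 (snd (g t))).
Proof.
intros E. unfold reflect1. rewrite Rminus_diag, E.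
destruct (g t) as [l [[[X1 X2] Y] Z]], lam as [[theta c] alpha]. simpl.
apply state_eq; field.
Qed.

(** Reversal negates derivatives, and passing from x to X - x negates them again, so x1 and x2 are
    driven by the controls of theta(t - s); the sign of c absorbs the reversal in the vertical part.
    The interval is the image of (a, b) under s -> t - s. *)
Lemma integral_curve_reflect1 (lam : Cov) (a b t : R) (g : R -> Cov * M) :
  integral_curve H_field (lam, q0) a b g -> a < t < b ->
  integral_curve H_field (eps_C eps1 (fst (g t)), q0) (t - b) (t - a) (reflect1 t g).
Proof.
intros (Hab & E & D) Ht. split; [lra|split].
- unfold reflect1. rewrite Rminus_0_r.
  destruct (g t) as [[[theta c] alpha] [[[X1 X2] Y] Z]]. simpl. unfold q0.
  apply state_eq; field.
- intros s Hs.
  assert (Hr : a < t - s < b) by lra. specialize (D (t - s) Hr).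
  apply H_field_coords in D. destruct D as (D0 & D1 & D2 & D3 & D4).
  apply Hv_coords in D0. destruct D0 as (Dth & Dc & Dal). cbv beta zeta in *.
  unfold reflect1.
  set (th := fun u => fst (fst (fst (g u)))) in *. set (c := fun u => snd (fst (fst (g u)))) in *.
  set (al := fun u => snd (fst (g u))) in *.
  set (x1 := fun u => fst (fst (fst (snd (g u))))) in *.
  set (x2 := fun u => snd (fst (fst (snd (g u))))) in *.
  set (y := fun u => snd (fst (snd (g u)))) in *. set (z := fun u => snd (snd (g u))) in *.
  assert (Eg : forall u, g u = ((th u, c u, al u), (x1 u, x2 u, y u, z u))).
  { intros u. unfold th, c, al, x1, x2, y, z.
    destruct (g u) as [[[? ?] ?] [[[? ?] ?] ?]]. reflexivity. }
  change (is_derive th (t - s) (- c (t - s))) in Dth.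
  change (is_derive c (t - s) (- al (t - s) * sinh (th (t - s)))) in Dc.
  change (is_derive al (t - s) 0) in Dal.
  change (is_derive x1 (t - s) (- sinh (th (t - s)))) in D1.
  change (is_derive x2 (t - s) (cosh (th (t - s)))) in D2.
  change (is_derive y (t - s)
    (/ 2 * (x2 (t - s) * sinh (th (t - s)) + x1 (t - s) * cosh (th (t - s))))) in D3.
  change (is_derive z (t - s)
    ((x1 (t - s) ^ 2 + x2 (t - s) ^ 2) / 2 * cosh (th (t - s)))) in D4.
  (* The coordinates become opaque scalar functions, of which only the derivatives at t - s are
     known. *)
  clearbody th c al x1 x2 y z.
  rewrite (Eg t), (Eg (t - s)).
  set (X1 := x1 t). set (X2 := x2 t). set (Y := y t). set (Z := z t).
  apply (is_derive_ext (fun u =>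
    ((th (t - u), - c (t - u), al (t - u)),
     (X1 - x1 (t - u), X2 - x2 (t - u),
      / 2 * (X1 * (X2 - x2 (t - u)) - X2 * (X1 - x1 (t - u))) - (Y - y (t - u)),
      (X1 ^ 2 + X2 ^ 2) / 2 * (X2 - x2 (t - u))
      - X1 * ((Y - y (t - u)) + / 2 * (X1 * X2 - x1 (t - u) * x2 (t - u)))
      - X2 * ((X2 ^ 2 - x2 (t - u) ^ 2) / 2) + (Z - z (t - u)))))).
  { intros u. now rewrite (Eg (t - u)). }
  rewrite !is_derive_pair. cbn [fst snd H_field Hv].
  assert (Fth := is_derive_unique (fun u : R => th u) _ _ Dth).
  assert (Fc := is_derive_unique (fun u : R => c u) _ _ Dc).
  assert (Fal := is_derive_unique (fun u : R => al u) _ _ Dal).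
  assert (F1 := is_derive_unique (fun u : R => x1 u) _ _ D1).
  assert (F2 := is_derive_unique (fun u : R => x2 u) _ _ D2).
  assert (F3 := is_derive_unique (fun u : R => y u) _ _ D3).
  assert (F4 := is_derive_unique (fun u : R => z u) _ _ D4).
  (* Seven scalar equations; once the known derivatives are substituted, each is a polynomial
     identity in the coordinates and in [sinh] and [cosh] of theta(t - s). *)
  refine (conj (conj (conj _ _) _) (conj (conj (conj _ _) _) _));
    (auto_derive; [repeat split; eexists; eassumption|]);
    change (t + - s) with (t - s);
    rewrite ?Fth, ?Fc, ?Fal, ?F1, ?F2, ?F3, ?F4; field.
Qed.

(** * Explosion time and the symmetries of [Exp] *)

(** If no integral curve passed t, then t would bound all right endpoints and hence their supremum.
    So an actual curve beyond t can be extracted. *)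
Lemma lt_explosion_time {V : NormedModule R_AbsRing} (F : V -> V) (v0 : V) (t : R) :
  Rbar_lt t (explosion_time F v0) <->
  exists (a b : R) (g : R -> V), integral_curve F v0 a b g /\ t < b.
Proof.
unfold explosion_time.
match goal with |- Rbar_lt _ (Lub_Rbar ?P) <-> _ => destruct (Lub_Rbar_correct P) as [Hub Hle] end.
split.
- intros Ht. apply NNPP. intros Hn. apply (Rbar_lt_not_le _ _ Ht), Hle.
  intros b (a & g & Hg). apply Rnot_lt_le. intros Hb. apply Hn. now exists a, b, g.
- intros (a & b & g & Hg & Hb). apply Rbar_lt_le_trans with b; [exact Hb|].
  apply Hub. now exists a, g.
Qed.

(** One integral curve reaching past t settles both the domain and the value; this serves the
    original extremal and its reflections alike. *)
Lemma Exp_eq (lam : Cov) (a b t : R) (g : R -> Cov * M) :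
  integral_curve H_field (lam, q0) a b g -> 0 < t < b ->
  N_dom (lam, t) /\ Exp (lam, t) = snd (g t).
Proof.
intros Hg Ht. split.
- split; [lra|]. apply lt_explosion_time. exists a, b, g. split; [exact Hg | lra].
- unfold Exp. f_equal. apply (flow_eq _ _ a b); [apply H_field_unique_forward | exact Hg | lra].
Qed.

Lemma Exp_eps3 (lam : Cov) (t : R) :
  N_dom (lam, t) ->
  N_dom (eps_N eps3 (lam, t)) /\ eps_M eps3 (Exp (lam, t)) = Exp (eps_N eps3 (lam, t)).
Proof.
intros [Ht H]. apply lt_explosion_time in H. destruct H as (a & b & g & Hg & Hb).
destruct (Exp_eq _ _ _ t _ Hg) as [_ ->]; [lra|].
destruct (Exp_eq _ _ _ t _ (integral_curve_reflect3 _ _ _ _ Hg)) as [Hd E]; [lra|].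
split; [exact Hd | now symmetry].
Qed.

Lemma Exp_eps1 (lam : Cov) (t : R) :
  N_dom (lam, t) ->
  N_dom (eps_N eps1 (lam, t)) /\ eps_M eps1 (Exp (lam, t)) = Exp (eps_N eps1 (lam, t)).
Proof.
intros [Ht H]. apply lt_explosion_time in H. destruct H as (a & b & g & Hg & Hb).
destruct (Exp_eq _ _ _ t _ Hg) as [_ ->]; [lra|].
(* The reflected curve exists up to t - a, which exceeds t because a is negative. *)
assert (Ha : a < 0) by apply Hg.
assert (Ef : flow Hv t lam = fst (g t)).
{ apply (flow_eq Hv lam a b t (fun s => fst (g s)) Hv_unique_forward); [|lra].
  exact (integral_curve_fst _ _ _ _ Hg). }
unfold eps_N. rewrite Ef.
destruct (Exp_eq _ _ _ t _ (integral_curve_reflect1 _ _ _ t _ Hg ltac:(lra))) as [Hd E]; [lra|].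
rewrite (reflect1_end _ lam) in E by apply Hg.
split; [exact Hd | now symmetry].
Qed.

(** Membership of the image in [N_dom] is asserted too, since past the explosion time the value of
    [flow] is unspecified. *)
Theorem proposition2 :
  forall (i : sym) (theta c alpha t : R),
    N_dom ((theta, c, alpha), t) ->
    N_dom (eps_N i ((theta, c, alpha), t)) /\
    eps_M i (Exp ((theta, c, alpha), t)) = Exp (eps_N i ((theta, c, alpha), t)).
Proof.
intros i theta c alpha t H. destruct i.
- now apply Exp_eps1.
- replace (eps_N Defs.eps2 (theta, c, alpha, t)) with (eps_N eps3 (eps_N eps1 (theta, c, alpha, t)))
    by (unfold eps_N; destruct (flow Hv t (theta, c, alpha)) as [[? ?] ?]; simpl; now rewrite Ropp_involutive).
  replace (eps_M Defs.eps2 (Exp (theta, c, alpha, t)))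
    with (eps_M eps3 (eps_M eps1 (Exp (theta, c, alpha, t))))
    by (destruct (Exp (theta, c, alpha, t)) as [[[? ?] ?] ?]; simpl; now rewrite Ropp_involutive).
  (* The domain half of [Exp_eps1] permits applying [Exp_eps3] at the image point. *)
  destruct (Exp_eps1 _ _ H) as [H1 E1]. destruct (Exp_eps3 _ _ H1) as [H3 E3].
  split; [exact H3 | exact (eq_trans (f_equal (eps_M eps3) E1) E3)].
- now apply Exp_eps3.
Qed.
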